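(* Let $E\subset\mathbb{R}^2$ be a boundary element with nodal basis vector $\boldsymbol{\phi}(\boldsymbol{x})\in\mathbb{R}^{N}$ and mass matrix $M$, let $\tilde{\boldsymbol{x}}$ be a point of the surrogate boundary on $E$, let $\bar{\boldsymbol{x}}$ be the corresponding point of the true boundary, let $\boldsymbol{u}\in\mathbb{R}^{N}$ be the coefficient vector of the internal polynomial $u_h(\boldsymbol{x})=\boldsymbol{\phi}^T(\boldsymbol{x})\boldsymbol{u}$, and let $u_D\in\mathbb{R}$ be the Dirichlet value prescribed at $\bar{\boldsymbol{x}}$. Let $\boldsymbol{v}\in\mathbb{R}^{N}$ be the solution, obtained by inversion, of the linear system $$M(\boldsymbol{v} - \boldsymbol{u}) + (\boldsymbol{\phi}^T(\bar{\boldsymbol{x}}) \boldsymbol{v} - u_D)\, \boldsymbol{\phi}(\bar{\boldsymbol{x}}) = \boldsymbol{0},$$ and let $\tilde u_D:=\boldsymbol{\phi}(\tilde{\boldsymbol{x}})^T\boldsymbol{v}$ be the ROD-$L^2$-w modified Dirichlet boundary condition at $\tilde{\boldsymbol{x}}$. Then $$\tilde u_D = [\boldsymbol{\phi}(\tilde{\boldsymbol{x}}) - \alpha\, \boldsymbol{\phi}(\bar{\boldsymbol{x}})]^T \boldsymbol{u} + \alpha\, u_D,\qquad \alpha = \frac{\boldsymbol{\phi}(\tilde{\boldsymbol{x}})^T M^{-1}\boldsymbol{\phi}(\bar{\boldsymbol{x}})}{1+\|\boldsymbol{\phi}(\bar{\boldsymbol{x}})\|^2_{M^{-1}}}.$$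
   Context: The boundary element $E$ is an affine image of the reference square $[-1,1]^2$. For a polynomial degree $p\ge 1$ and $N=(p+1)^2$, $\boldsymbol{\phi}=[\phi_1,\ldots,\phi_N]^T$ is the vector of nodal (Lagrange) basis polynomials on $E$, namely the tensor-product Lagrange polynomials of degree $p$ in each variable associated with the tensor-product Gauss-Lobatto-Legendre points. They form a basis of the local polynomial space. As polynomials they are also evaluated at points outside $E$, so $\boldsymbol{\phi}(\bar{\boldsymbol{x}})$ makes sense even when $\bar{\boldsymbol{x}}\notin E$. The mass matrix is $M_{ij}=\int_E \phi_i\phi_j\,d\boldsymbol{x}$, which is symmetric positive definite. For $\boldsymbol{a}\in\mathbb{R}^N$, $\|\boldsymbol{a}\|_{M^{-1}}^2:=\boldsymbol{a}^TM^{-1}\boldsymbol{a}$. The surrogate boundary is the boundary of the unfitted computational mesh to which $E$ belongs; each of its points $\tilde{\boldsymbol{x}}$ is mapped to a point $\bar{\boldsymbol{x}}$ of the true boundary of the physical domain, where the boundary condition is prescribed. The linear system is the optimality condition of the functional $\mathcal{L}(\boldsymbol{v})=\frac12\|\boldsymbol{\phi}^T\boldsymbol{v}-u_h\|_{L^2(E)}^2+\frac12(\boldsymbol{\phi}(\bar{\boldsymbol{x}})^T\boldsymbol{v}-u_D)^2$. *)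

(* Defs.v *)
From HB Require Import structures.
From mathcomp Require Import all_boot all_order all_algebra.
From mathcomp Require Import all_classical all_reals all_analysis.

Set Implicit Arguments.
Unset Strict Implicit.
Unset Printing Implicit Defensive.

Import Order.TTheory GRing.Theory Num.Theory.
Import numFieldNormedType.Exports.

Local Open Scope classical_set_scope.
Local Open Scope ring_scope.

Section OneDimensional.
Variables (R : realType) (p : nat).

(* Rodrigues' formula *)
Definition legendre : {poly R} :=
  ((2 ^ p * p`!)%:R)^-1 *: (('X ^+ 2 - 1) ^+ p)^`(p).

(* The p+1 Gauss-Lobatto-Legendre points of [-1,1], listed in increasing order:
   the two endpoints together with the p-1 zeros of the derivative of the
   Legendre polynomial of degree p. Meaningful for p >= 1. *)
Definition gauss_lobatto_legendre (xi : 'I_p.+1 -> R) : Prop :=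
  [/\ {homo xi : i j / (i < j)%N >-> i < j},
      xi ord0 = -1, xi ord_max = 1 &
      forall i, i != ord0 -> i != ord_max -> root legendre^`() (xi i)].

(* The Lagrange basis of qpoly.v is indexed by an injective sequence nat -> R;
   here only the p+1 nodes are given. *)
Definition lagrange1 (xi : 'I_p.+1 -> R) (k : 'I_p.+1) : {poly R} :=
  \prod_(m < p.+1 | m != k) ((xi k - xi m)^-1 *: ('X - (xi m)%:P)).

End OneDimensional.

Section Element.
Variable R : realType.

Definition affine_map (A : 'M[R]_2) (b s : R * R) : R * R :=
  (A 0 0 * s.1 + A 0 1 * s.2 + b.1, A 1 0 * s.1 + A 1 1 * s.2 + b.2).

Definition ref_square : set (R * R) := `[-1, 1] `*` `[-1, 1].

Definition element (A : 'M[R]_2) (b : R * R) : set (R * R) :=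
  affine_map A b @` ref_square.

(* inverse of affine_map A b when A \in unitmx *)
Definition ref_coord (A : 'M[R]_2) (b x : R * R) : R * R :=
  affine_map (invmx A) 0 (x - b).

(* The N = (p+1)^2 tensor-product Lagrange polynomials, enumerated by mxvec as a
   column vector and evaluated at an arbitrary point x of the plane. *)
Definition nodal_basis (p : nat) (xi : 'I_p.+1 -> R) (A : 'M[R]_2) (b x : R * R) :
    'cV[R]_(p.+1 * p.+1) :=
  (mxvec (\matrix_(i, j) ((lagrange1 xi i).[(ref_coord A b x).1] *
                          (lagrange1 xi j).[(ref_coord A b x).2])))^T.

Definition mass_matrix (p : nat) (xi : 'I_p.+1 -> R) (A : 'M[R]_2) (b : R * R) :
    'M[R]_(p.+1 * p.+1) :=
  \matrix_(i, j) \int[(lebesgue_measure \x lebesgue_measure)%E]_(x in element A b)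
    (nodal_basis xi A b x i 0 * nodal_basis xi A b x j 0).

Definition boundary (S : set (R * R)) : set (R * R) := closure S `\` interior S.

(* boundary of the region covered by the elements of a mesh *)
Definition surrogate_boundary (mesh : set (set (R * R))) : set (R * R) :=
  boundary (\bigcup_(K in mesh) K).

End Element.

Section Vectors.
Variables (R : realType) (n : nat).

Definition dot (a b : 'cV[R]_n) : R := (a^T *m b) 0 0.

Definition sqnorm_inv (M : 'M[R]_n) (a : 'cV[R]_n) : R := dot a (invmx M *m a).

End Vectors.

(* Main.v *)
Require Import Defs.
From HB Require Import structures.
From mathcomp Require Import all_boot all_order all_algebra.
From mathcomp Require Import all_classical all_reals all_analysis.
From mathcomp Require Import measurable_realfun.
From mathcomp Require Import ring lra.

(** The system reads [(M + b b^T) v = M u + uD b] with [b = phi xbar]: the mass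
    matrix is perturbed by a rank-one term. Hence [v] differs from [u] only by
    a multiple of [M^-1 b], and the scalar multiple is the residual
    [b^T v - uD]. Multiplying by [b^T] turns this into one scalar equation for
    the residual, whose coefficient is [1 + b^T M^-1 b]; solving it and
    multiplying [v] by [phi xt] gives the claim ([rank_one_update_solution]).

    Two facts are needed to divide: [M] is invertible and [1 + b^T M^-1 b] is
    nonzero. Both follow from the positive definiteness of [M]
    ([posdef_mass_matrix]), which carries all the analysis. Since [M] is the
    Gram matrix of the basis in [L^2(E)], the quadratic form at [w] is the
    integral over [E] of the square of the polynomial [g = w^T phi]
    ([dot_gram_matrix]). If [w] is nonzero, so is one of its entries, and that
    entry is the value of [g] at a node. The node may lie on the boundary of
    [E], but [g] is continuous and the node is a limit of interior points of [E]
    along the ray from the centre, so [g] is nonzero at an interior point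
    ([nodal_basis_interior_neq0]), hence on a rectangle of positive area, and
    the integral is positive ([leb2_Rintegral_sqr_gt0]). *)

Import Order.TTheory GRing.Theory Num.Theory.
Import numFieldNormedType.Exports.

Local Open Scope classical_set_scope.
Local Open Scope ring_scope.

Set Implicit Arguments.
Unset Strict Implicit.
Unset Printing Implicit Defensive.

(** * Rank-one perturbation of a positive definite system *)

Lemma dotE (R : realType) (n : nat) (a b : 'cV[R]_n) :
  dot a b = \sum_i a i 0 * b i 0.
Proof. by rewrite /dot mxE; apply: eq_bigr => i _; rewrite mxE. Qed.

Lemma dotC (R : realType) (n : nat) (a b : 'cV[R]_n) : dot a b = dot b a.
Proof. by rewrite !dotE; apply: eq_bigr => i _; rewrite mulrC. Qed.

Lemma dotBl (R : realType) (n : nat) (a b c : 'cV[R]_n) :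
  dot (a - b) c = dot a c - dot b c.
Proof. by rewrite /dot linearB /= mulmxBl !mxE. Qed.

Lemma dotBr (R : realType) (n : nat) (a b c : 'cV[R]_n) :
  dot a (b - c) = dot a b - dot a c.
Proof. by rewrite dotC dotBl !(dotC a). Qed.

Lemma dotZl (R : realType) (n : nat) (k : R) (a b : 'cV[R]_n) :
  dot (k *: a) b = k * dot a b.
Proof. by rewrite /dot linearZ /= -scalemxAl mxE. Qed.

Lemma dotZr (R : realType) (n : nat) (k : R) (a b : 'cV[R]_n) :
  dot a (k *: b) = k * dot a b.
Proof. by rewrite dotC dotZl dotC. Qed.

Definition posdef (R : realType) (n : nat) (M : 'M[R]_n) : Prop :=
  forall w : 'cV[R]_n, w != 0 -> 0 < dot w (M *m w).

(** The quadratic form vanishes at a vector of the kernel. *)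
Lemma posdef_unitmx (R : realType) (n : nat) (M : 'M[R]_n) :
  posdef M -> M \in unitmx.
Proof.
move=> Mpos; rewrite unitmxE unitfE; apply/negP => /det0P[r r0 rM0].
have /Mpos : r^T != 0 by rewrite trmx_eq0.
by rewrite /dot trmxK mulmxA rM0 mul0mx mxE ltxx.
Qed.

(** Substituting [a := M *m w] turns [a^T M^-1 a] into the transpose of
    [w^T M w]. *)
Lemma posdef_sqnorm_inv_ge0 (R : realType) (n : nat) (M : 'M[R]_n)
  (a : 'cV[R]_n) : posdef M -> 0 <= sqnorm_inv M a.
Proof.
move=> Mpos; rewrite /sqnorm_inv; set w := invmx M *m a.
have -> : a = M *m w by rewrite mulKVmx// posdef_unitmx.
rewrite dotC; have [->|/Mpos/ltW//] := eqVneq w 0.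
by rewrite mulmx0 /dot mulmx0 mxE.
Qed.

(** The residual [c := b^T v - d] is an unknown scalar: [v = u - c M^-1 b], and
    taking the product with [b] gives [c (1 + |b|^2) = b^T u - d], which is the
    Sherman--Morrison formula for the matrix [M + b b^T]. *)
Lemma rank_one_update_solution (R : realType) (n : nat) (M : 'M[R]_n)
  (a b u v : 'cV[R]_n) (d : R) :
  M \in unitmx -> 1 + sqnorm_inv M b != 0 ->
  M *m (v - u) + (dot b v - d) *: b = 0 ->
  let alpha := dot a (invmx M *m b) / (1 + sqnorm_inv M b) in
  dot a v = dot (a - alpha *: b) u + alpha * d.
Proof.
move=> Mu s0 /eqP; rewrite addr_eq0 => /eqP.
set c := dot b v - d; set w := invmx M *m b => vuE alpha.
(* The system, multiplied by the inverse of M, with w the direction M^-1 b. *)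
have vE : v = u - c *: w.
  rewrite scalemxAr -[c *: b]opprK -vuE mulmxN mulKmx//.
  by rewrite opprK addrC subrK.
(* Product of the previous equation with b. *)
have cE : c * (1 + sqnorm_inv M b) = dot b u - d.
  by rewrite mulrDr mulr1 {1}/c {1}vE dotBr dotZr /sqnorm_inv -/w; ring.
have -> : dot a v = dot a u - c * dot a w by rewrite vE dotBr dotZr.
have -> : c = (dot b u - d) / (1 + sqnorm_inv M b) by rewrite -cE mulfK.
by rewrite dotBl dotZl /alpha; ring.
Qed.

(** * The quadratic form of a Gram matrix *)

Lemma Rintegral_sum (d : measure_display) (T : measurableType d) (R : realType)
  (mu : {measure set T -> \bar R}) (D : set T) (I : Type) (r : seq I)
  (f : I -> T -> R) :
  measurable D -> (forall i, mu.-integrable D (EFin \o f i)) ->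
  \int[mu]_(x in D) (\sum_(i <- r) f i x) =
  \sum_(i <- r) \int[mu]_(x in D) f i x.
Proof.
move=> mD intf; elim: r => [|i r IHr].
  under eq_Rintegral do rewrite big_nil.
  by rewrite Rintegral_cst// mul0r big_nil.
under eq_Rintegral do rewrite big_cons.
rewrite big_cons RintegralD ?IHr//.
have -> : EFin \o (fun x => \sum_(j <- r) f j x) =
          (fun x => \sum_(j <- r) (EFin \o f j) x)%E.
  by apply/funext => x /=; rewrite sumEFin.
by apply: (integrable_sum mD).
Qed.

(** Expanding the square of [\sum_i w_i f_i] and integrating term by term; the
    integrability of the products is what makes the expansion legitimate. *)
Lemma dot_gram_matrix (d : measure_display) (T : measurableType d)
  (R : realType) (mu : {measure set T -> \bar R}) (D : set T) (n : nat)
  (f : T -> 'cV[R]_n) (w : 'cV[R]_n) :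
  measurable D ->
  (forall i j, mu.-integrable D (EFin \o (fun x => f x i 0 * f x j 0))) ->
  dot w ((\matrix_(i, j) \int[mu]_(x in D) (f x i 0 * f x j 0)) *m w) =
  \int[mu]_(x in D) (dot w (f x)) ^+ 2.
Proof.
move=> mD intf.
have intZ i j (k : R) :
    mu.-integrable D (EFin \o (fun x => k * (f x i 0 * f x j 0))).
  have -> : EFin \o (fun x => k * (f x i 0 * f x j 0)) =
      (fun x => k%:E * (EFin \o (fun x => f x i 0 * f x j 0)%R) x)%E.
    by apply/funext => x.
  exact: (integrableZl mD).
transitivity (\int[mu]_(x in D) \sum_(ij : 'I_n * 'I_n)
    (w ij.1 0 * w ij.2 0 * (f x ij.1 0 * f x ij.2 0))); last first.
  apply: eq_Rintegral => x _; rewrite dotE expr2 big_distrlr/= pair_bigA/=.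
  by apply: eq_bigr => -[i j] _ /=; rewrite mulrACA.
rewrite Rintegral_sum// dotE.
under eq_bigr do rewrite mxE big_distrr/=.
rewrite pair_bigA/=; apply: eq_bigr => -[i j] _ /=.
by rewrite RintegralZl// mxE; ring.
Qed.

(** * Planar Lebesgue integrals of continuous functions *)

(** The sigma-algebra of the product measure, to be distinguished from the
    topological product [R * R] on the same carrier. *)
Notation plane R := (measurableTypeR R * measurableTypeR R)%type.
Notation leb2 R := (@lebesgue_measure R \x @lebesgue_measure R)%E.

(** A product of two balls is a rectangle, whose area is explicit. The set [B]
    is needed because a neighbourhood need not be measurable. *)
Lemma leb2_nbhs_gt0 (R : realType) (x : R * R) (N : set (R * R)) :
  nbhs x N -> exists2 B : set (plane R), measurable B /\ B `<=` N & (0 < leb2 R B)%E.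
Proof.
move=> [[P Q] /= [/nbhs_ballP[e e0 eP] /nbhs_ballP[e' e'0 e'Q]] PQN].
have mb (y r : R) : measurable (ball y r : set (measurableTypeR R)).
  by rewrite ball_itv; exact: measurable_itv.
exists (ball x.1 e `*` ball x.2 e').
  split; first exact: measurableX.
  by move=> y [/eP Py /e'Q Qy]; exact: PQN.
rewrite [ltRHS]product_measure1E//.
rewrite [X in (_ < X * _)%E](lebesgue_measure_ball _ (ltW e0)).
rewrite [X in (_ < _ * X)%E](lebesgue_measure_ball _ (ltW e'0)).
by rewrite -EFinM lte_fin mulr_gt0 ?pmulrn_lgt0.
Qed.

(** A compact set lies in the product of its two projections, which are compact
    subsets of the line. *)
Lemma leb2_compact_lty (R : realType) (D : set (R * R)) :
  compact D -> measurable (D : set (plane R)) ->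
  (leb2 R D < +oo)%E.
Proof.
move=> cD mD.
have c1 : compact (fst @` D).
  by apply: continuous_compact => //; apply: continuous_subspaceT => x; exact: cvg_fst.
have c2 : compact (snd @` D).
  by apply: continuous_compact => //; apply: continuous_subspaceT => x; exact: cvg_snd.
have DX : D `<=` (fst @` D) `*` (snd @` D).
  by move=> x Dx; split; exists x.
have m1 := compact_measurable c1; have m2 := compact_measurable c2.
apply: (@le_lt_trans _ _ (leb2 R ((fst @` D) `*` (snd @` D)))).
  by apply: le_measure; rewrite ?inE//; exact: measurableX.
rewrite [ltLHS]product_measure1E//.
by apply: lte_mul_pinfty; rewrite ?measure_ge0 ?ge0_fin_numE ?compact_finite_measure.
Qed.

Lemma leb2_continuous_integrable (R : realType) (D : set (R * R))
  (f : R * R -> R) :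
  compact D -> measurable (D : set (plane R)) ->
  measurable_fun setT (f : plane R -> R) ->
  continuous f -> (leb2 R).-integrable D (EFin \o f).
Proof.
move=> cD mD mf cf; apply: measurable_bounded_integrable => //.
- exact: leb2_compact_lty.
- exact: measurable_funTS.
- have /compact_bounded[M [_ mrt]] :=
    @continuous_compact _ R^o f _ (continuous_subspaceT cf) cD.
  by exists M; split; rewrite ?num_real // => ? ? ? ?; exact: mrt.
Qed.

(** The square equals its absolute value, so a zero integral makes it vanish
    almost everywhere. *)
Lemma Rintegral_sqr_eq0 (d : measure_display) (T : measurableType d)
  (R : realType) (mu : {measure set T -> \bar R}) (D : set T) (g : T -> R) :
  measurable D -> mu.-integrable D (EFin \o (fun x => g x ^+ 2)) ->
  \int[mu]_(x in D) (g x ^+ 2) = 0 ->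
  mu.-negligible (D `&` [set x | g x != 0]).
Proof.
move=> mD intg int0.
have : (\int[mu]_(x in D) `|(EFin \o (fun x => g x ^+ 2)%R) x| = 0)%E.
  rewrite (eq_integral (EFin \o (fun x => g x ^+ 2))); last first.
    by move=> x _; rewrite gee0_abs// lee_fin sqr_ge0.
  by rewrite -[LHS]fineK ?integrable_fin_num// -[fine _]/(Rintegral _ _ _) int0.
move=> /(ae_eq_integral_abs _ mD (measurable_int _ intg)).
apply: negligibleS => x [Dx /= gx] /(_ Dx) [] /eqP.
by rewrite sqrf_eq0; apply/negP.
Qed.

(** Otherwise [g] would vanish almost everywhere on [D], although by continuity
    it is nonzero on a rectangle around [x0] contained in [D]. *)
Lemma leb2_Rintegral_sqr_gt0 (R : realType) (D : set (R * R))
  (g : R * R -> R) (x0 : R * R) :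
  measurable (D : set (plane R)) ->
  (leb2 R).-integrable D (EFin \o (fun x => g x ^+ 2)) ->
  continuous g -> D^° x0 -> g x0 != 0 ->
  0 < \int[leb2 R]_(x in D) (g x ^+ 2).
Proof.
move=> mD intg cg Dx0 gx0.
rewrite lt_neqAle Rintegral_ge0 ?andbT; last by move=> x _; exact: sqr_ge0.
apply/negP => /eqP/esym /(Rintegral_sqr_eq0 mD intg)[Z [mZ Z0 DZ]].
have : nbhs x0 (D `&` [set x | g x != 0]).
  apply: filterI => //; apply: (cg x0 [set y | y != 0]).
  by apply: open_nbhs_nbhs; split=> //; exact: open_neq.
move=> /leb2_nbhs_gt0[B [mB BN]].
apply/negP; rewrite -leNgt -Z0; apply: le_measure; rewrite ?inE//.
exact: subset_trans BN DZ.
Qed.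

(** * Geometry of the element *)

(** One computation covers both composites of [affine_map] and [ref_coord]:
    [b = 0] gives the left inverse and [c = 0] the right inverse. *)
Lemma affine_map_inv (R : realType) (A B : 'M[R]_2) (b c s : R * R) :
  A *m B = 1%:M -> affine_map A b (affine_map B c s - c) = s + b.
Proof.
move=> /matrixP AB; have ab i j : A i 0 * B 0 j + A i 1 * B 1 j = (i == j)%:R.
  have := AB i j; rewrite !mxE !big_ord_recl big_ord0 addr0 => <-.
  by rewrite (_ : lift ord0 ord0 = 1); last exact: val_inj.
rewrite /affine_map; case: s c b => s t [c d] [b e] /=; rewrite !addrK.
congr pair.
- transitivity ((A 0 0 * B 0 0 + A 0 1 * B 1 0) * s +
                (A 0 0 * B 0 1 + A 0 1 * B 1 1) * t + b); first by ring.
  by rewrite !ab mul1r mul0r addr0.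
- transitivity ((A 1 0 * B 0 0 + A 1 1 * B 1 0) * s +
                (A 1 0 * B 0 1 + A 1 1 * B 1 1) * t + e); first by ring.
  by rewrite !ab mul1r mul0r add0r.
Qed.

Lemma ref_coordK (R : realType) (A : 'M[R]_2) (b : R * R) :
  A \in unitmx -> cancel (affine_map A b) (ref_coord A b).
Proof.
by move=> Au s; rewrite /ref_coord affine_map_inv ?addr0//; exact: mulVmx.
Qed.

Lemma affine_mapK (R : realType) (A : 'M[R]_2) (b : R * R) :
  A \in unitmx -> cancel (ref_coord A b) (affine_map A b).
Proof.
move=> Au s; rewrite /ref_coord -[affine_map _ 0 _]subr0.
by rewrite affine_map_inv ?subrK//; exact: mulmxV.
Qed.

(** The image of the square is hard to measure directly; as a preimage under a
    measurable map it is measurable. *)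
Lemma element_preimage (R : realType) (A : 'M[R]_2) (b : R * R) :
  A \in unitmx -> element A b = ref_coord A b @^-1` (@ref_square R).
Proof.
move=> Au; apply/seteqP; split => [_ [s ss <-]|x xs] /=.
  by rewrite ref_coordK.
by exists (ref_coord A b x); rewrite ?affine_mapK.
Qed.

Lemma continuous_affine_map (R : realType) (A : 'M[R]_2) (b : R * R) :
  continuous (affine_map A b).
Proof.
move=> x.
have c (k l m : R) :
    {for x, continuous (fun s : R * R => k * s.1 + l * s.2 + m)}.
  apply: cvgD; last exact: cvg_cst.
  by apply: cvgD; apply: cvgM; (try exact: cvg_cst);
    [exact: cvg_fst|exact: cvg_snd].
exact: (cvg_pair (c _ _ _) (c _ _ _)).
Qed.

Lemma measurable_affine_map (R : realType) (A : 'M[R]_2) (b : R * R) :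
  measurable_fun setT (affine_map A b : plane R -> plane R).
Proof.
have m (k l n : R) : measurable_fun setT
    (fun s : plane R => k * s.1 + l * s.2 + n : measurableTypeR R).
  by apply: measurable_funD => //; apply: measurable_funD;
    apply: measurable_funM.
exact: (measurable_fun_pair (m _ _ _) (m _ _ _)).
Qed.

(** The inverse is affine as well, so that continuity and measurability need be
    shown for [affine_map] only. *)
Lemma ref_coord_affine_map (R : realType) (A : 'M[R]_2) (b : R * R) :
  ref_coord A b = affine_map (invmx A) (affine_map (invmx A) 0 (- b)).
Proof.
by apply/funext => x; rewrite /ref_coord /affine_map/=; congr pair; ring.
Qed.

Lemma continuous_ref_coord (R : realType) (A : 'M[R]_2) (b : R * R) :
  continuous (ref_coord A b).
Proof. by rewrite ref_coord_affine_map; exact: continuous_affine_map. Qed.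

Lemma measurable_ref_coord (R : realType) (A : 'M[R]_2) (b : R * R) :
  measurable_fun setT (ref_coord A b : plane R -> plane R).
Proof. by rewrite ref_coord_affine_map; exact: measurable_affine_map. Qed.

Lemma measurable_element (R : realType) (A : 'M[R]_2) (b : R * R) :
  A \in unitmx -> measurable (element A b : set (plane R)).
Proof.
move=> Au; rewrite element_preimage// -[X in measurable X]setTI.
by apply: measurable_ref_coord => //; apply: measurableX.
Qed.

Lemma compact_element (R : realType) (A : 'M[R]_2) (b : R * R) :
  compact (element A b).
Proof.
apply: continuous_compact.
  by apply: continuous_subspaceT; exact: continuous_affine_map.
by apply: compact_setX; exact: segment_compact.
Qed.

(** Preimages of open sets under the continuous inverse map are open. *)
Lemma interior_element (R : realType) (A : 'M[R]_2) (b s : R * R) :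
  A \in unitmx -> `]-1, 1[%classic s.1 -> `]-1, 1[%classic s.2 ->
  (element A b)^° (affine_map A b s).
Proof.
move=> Au s1 s2; rewrite /interior /= element_preimage//.
apply: (continuous_ref_coord); rewrite ref_coordK//.
exists (`]-1, 1[%classic, `]-1, 1[%classic) => /=.
  by split; apply: open_nbhs_nbhs; split => //; exact: interval_open.
by move=> y [/= y1 y2]; split; apply: subset_itv_oo_cc.
Qed.

(** * The nodal basis *)

Lemma lagrange1_node (R : realType) (p : nat) (xi : 'I_p.+1 -> R)
  (k l : 'I_p.+1) :
  injective xi -> (lagrange1 xi k).[xi l] = (k == l)%:R.
Proof.
move=> xi_inj; rewrite horner_prod; have [<-|kl] := eqVneq k l.
  rewrite big1// => m mk; rewrite !hornerE mulVf// subr_eq0.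
  by rewrite (inj_eq xi_inj) eq_sym.
by rewrite (bigD1 l) 1?eq_sym//= !hornerE subrr mulr0 mul0r.
Qed.

Lemma nodal_basisE (R : realType) (p : nat) (xi : 'I_p.+1 -> R) (A : 'M[R]_2)
  (b x : R * R) (i j : 'I_p.+1) :
  nodal_basis xi A b x (mxvec_index i j) 0 =
  (lagrange1 xi i).[(ref_coord A b x).1] * (lagrange1 xi j).[(ref_coord A b x).2].
Proof. by rewrite mxE mxvecE mxE. Qed.

Lemma continuous_nodal_basis (R : realType) (p : nat) (xi : 'I_p.+1 -> R)
  (A : 'M[R]_2) (b : R * R) (k : 'I_(p.+1 * p.+1)) :
  continuous (fun x => nodal_basis xi A b x k 0).
Proof.
case/mxvec_indexP: k => i j x.
under eq_fun do rewrite nodal_basisE.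
have cr := @continuous_ref_coord R A b x.
have cfst : continuous (@fst R R) by move=> y; exact: cvg_fst.
have csnd : continuous (@snd R R) by move=> y; exact: cvg_snd.
have c1 : {for x, continuous (fun y => (ref_coord A b y).1)}.
  exact: (continuous_comp cr (cfst _)).
have c2 : {for x, continuous (fun y => (ref_coord A b y).2)}.
  exact: (continuous_comp cr (csnd _)).
exact: (cvgM (continuous_comp c1 (@continuous_horner R _ _))
             (continuous_comp c2 (@continuous_horner R _ _))).
Qed.

Lemma measurable_nodal_basis (R : realType) (p : nat) (xi : 'I_p.+1 -> R)
  (A : 'M[R]_2) (b : R * R) (k : 'I_(p.+1 * p.+1)) :
  measurable_fun setT ((fun x => nodal_basis xi A b x k 0) : plane R -> R).
Proof.
case/mxvec_indexP: k => i j.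
under eq_fun do rewrite nodal_basisE.
have mh (q : {poly R}) : measurable_fun setT (horner q).
  by apply: continuous_measurable_fun; exact: continuous_horner.
have mr := @measurable_ref_coord R A b.
by apply: measurable_funM; apply: (measurableT_comp (mh _));
  apply: (measurableT_comp _ mr).
Qed.

Lemma continuous_dot_nodal_basis (R : realType) (p : nat) (xi : 'I_p.+1 -> R)
  (A : 'M[R]_2) (b : R * R) (w : 'cV[R]_(p.+1 * p.+1)) :
  continuous (fun x => dot w (nodal_basis xi A b x)).
Proof.
under eq_fun do rewrite dotE.
apply: continuous_big => [|k _ x]; first exact: add_continuous.
apply: cvgM; first exact: cvg_cst.
exact: continuous_nodal_basis.
Qed.

Lemma measurable_dot_nodal_basis (R : realType) (p : nat) (xi : 'I_p.+1 -> R)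
  (A : 'M[R]_2) (b : R * R) (w : 'cV[R]_(p.+1 * p.+1)) :
  measurable_fun setT ((fun x => dot w (nodal_basis xi A b x)) : plane R -> R).
Proof.
under eq_fun do rewrite dotE.
apply: measurable_sum => k; apply: measurable_funM => //.
exact: measurable_nodal_basis.
Qed.

Lemma gauss_lobatto_legendre_inj (R : realType) (p : nat) (xi : 'I_p.+1 -> R) :
  gauss_lobatto_legendre xi -> injective xi.
Proof.
move=> [xi_mono _ _ _] i j ij.
have [/xi_mono|/xi_mono|/ord_inj//] := ltngtP (i : nat) j;
  by rewrite ij ltxx.
Qed.

Lemma gauss_lobatto_legendre_itv (R : realType) (p : nat) (xi : 'I_p.+1 -> R) (i : 'I_p.+1) :
  gauss_lobatto_legendre xi -> -1 <= xi i <= 1.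
Proof.
move=> [xi_mono xi0 xi1 _]; apply/andP; split.
- have [->|i0] := eqVneq i ord0; first by rewrite xi0.
  by rewrite -[leLHS]xi0; apply/ltW/xi_mono; rewrite lt0n.
- have [->|i1] := eqVneq i ord_max; first by rewrite xi1.
  by rewrite -[leRHS]xi1; apply/ltW/xi_mono; rewrite ltn_neqAle i1 -ltnS /=.
Qed.

(** Nodal interpolation: coefficients are point values, which is how a nonzero
    vector of coefficients is recognized as a nonzero function. *)
Lemma dot_nodal_basis_node (R : realType) (p : nat) (xi : 'I_p.+1 -> R)
  (A : 'M[R]_2) (b : R * R) (w : 'cV[R]_(p.+1 * p.+1)) (i j : 'I_p.+1) :
  injective xi -> A \in unitmx ->
  dot w (nodal_basis xi A b (affine_map A b (xi i, xi j))) =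
  w (mxvec_index i j) 0.
Proof.
move=> xi_inj Au; rewrite dotE (bigD1 (mxvec_index i j))//= big1 => [|k].
  by rewrite nodal_basisE ref_coordK// !lagrange1_node// !eqxx !mulr1 addr0.
case/mxvec_indexP: k => k l klij.
rewrite nodal_basisE ref_coordK// !lagrange1_node//=.
move: klij; have [->|_ _] := eqVneq k i; last by rewrite mul0r mulr0.
by have [->|_ _] := eqVneq l j; rewrite ?eqxx// !mulr0.
Qed.

(** A nonzero coefficient gives a node where the function is nonzero. Nodes may
    lie on the boundary of the element, so the point is moved slightly towards
    the centre of the reference square. *)
Lemma nodal_basis_interior_neq0 (R : realType) (p : nat) (xi : 'I_p.+1 -> R)
  (A : 'M[R]_2) (b : R * R) (w : 'cV[R]_(p.+1 * p.+1)) :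
  gauss_lobatto_legendre xi -> A \in unitmx -> w != 0 ->
  exists2 x, (element A b)^° x & dot w (nodal_basis xi A b x) != 0.
Proof.
move=> gll Au w0.
have [k wk0] : exists k, w k 0 != 0.
  apply/existsP; apply: contra_neqT w0 => /existsPn wk.
  by apply/matrixP => k l; rewrite ord1 mxE; apply/eqP/negPn/wk.
case/mxvec_indexP: k wk0 => i j wij0.
(* The ray from the centre of the reference square; seg 1 is the node. *)
pose seg (r : R) : R * R := (r * xi i, r * xi j).
have seg_cont : continuous seg.
  move=> r; have c k : {for r, continuous (fun t : R => t * xi k)}.
    by apply: cvgM; [exact: cvg_id|exact: cvg_cst].
  exact: (cvg_pair (c i) (c j)).
pose path r := affine_map A b (seg r).
have path_cont : continuous path.
  move=> r; exact: (continuous_comp (@seg_cont r)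
    (@continuous_affine_map R A b _)).
pose h r := dot w (nodal_basis xi A b (path r)).
have h_cont : continuous h.
  move=> r; exact: (continuous_comp (@path_cont r)
    (@continuous_dot_nodal_basis _ _ xi A b w _)).
have near1 : \forall r \near (1 : R)^'-, h r != 0.
  have h1 : h 1 != 0.
    by rewrite /h /path /seg !mul1r dot_nodal_basis_node//; exact: gauss_lobatto_legendre_inj.
  apply: (cvg_at_left_filter (h_cont 1) (t := [set y | y != 0])).
  by apply: open_nbhs_nbhs; split; first exact: open_neq.
have [r [rn0 r0 r1]] : exists r : R,
    [/\ h r != 0, 0 < r & r < 1].
  apply: (@filter_ex _ ((1 : R)^'-)); near=> r; split.
  - by near: r.
  - by near: r; exact: nbhs_left_gt.
  - by near: r; exact: nbhs_left_lt.
have itv k : `]-1, 1[%classic (r * xi k).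
  by rewrite /= in_itv/=; have /andP[] := gauss_lobatto_legendre_itv k gll; nra.
by exists (path r) => //; apply: (@interior_element R A b (seg r)) => //; exact: itv.
Unshelve. all: by end_near. Qed.

(** * Positive definiteness of the mass matrix *)

Lemma posdef_mass_matrix (R : realType) (p : nat) (xi : 'I_p.+1 -> R)
  (A : 'M[R]_2) (b : R * R) :
  gauss_lobatto_legendre xi -> A \in unitmx -> posdef (mass_matrix xi A b).
Proof.
move=> gll Au w w0; have mE := measurable_element b Au.
have cE := @compact_element R A b.
rewrite /mass_matrix dot_gram_matrix//; last first.
  move=> i j; apply: leb2_continuous_integrable => //.
    by apply: measurable_funM; exact: measurable_nodal_basis.
  by move=> x; apply: cvgM; exact: continuous_nodal_basis.
have [x0 Ex0 gx0] := nodal_basis_interior_neq0 b gll Au w0.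
apply: (leb2_Rintegral_sqr_gt0 mE _ _ Ex0 gx0); last first.
  exact: continuous_dot_nodal_basis.
apply: leb2_continuous_integrable => //.
  by apply: measurable_funX; exact: measurable_dot_nodal_basis.
by move=> x; apply: cvgM; exact: continuous_dot_nodal_basis.
Qed.

Theorem proposition4
  (R : realType) (p : nat) (hp : (1 <= p)%N)
  (xi : 'I_p.+1 -> R) (hxi : gauss_lobatto_legendre xi)
  (A : 'M[R]_2) (b : R * R) (hA : A \in unitmx)
  (mesh : set (set (R * R))) (hmesh : finite_set mesh)
  (hE : mesh (element A b))
  (Omega : set (R * R)) (bmap : R * R -> R * R)
  (hbmap : forall x, surrogate_boundary mesh x -> boundary Omega (bmap x))
  (xt : R * R) (hxtE : element A b xt) (hxt : surrogate_boundary mesh xt)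
  (xbar : R * R) (hxbar : xbar = bmap xt)
  (uD : R) (u v : 'cV[R]_(p.+1 * p.+1)) :
  let phi := nodal_basis xi A b in
  let M := mass_matrix xi A b in
  M *m (v - u) + (dot (phi xbar) v - uD) *: phi xbar = 0 ->
  let uDt := dot (phi xt) v in
  let alpha := dot (phi xt) (invmx M *m phi xbar) /
               (1 + sqnorm_inv M (phi xbar)) in
  uDt = dot (phi xt - alpha *: phi xbar) u + alpha * uD.
Proof.
move=> phi M vE uDt alpha.
have Mpos : posdef M by exact: posdef_mass_matrix.
apply: rank_one_update_solution vE; first exact: posdef_unitmx.
by rewrite gt_eqF// ltr_pwDl// posdef_sqnorm_inv_ge0.
Qed.
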